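(* Fix $(\alpha_A^+,T_+)$ with $T_+>0$, $0<\alpha_A^+<1$, and $u_+\ne u_A$. Then, in the region $\alpha_A^+<\alpha_A<1$, the intersection point of the compressive part of $G(\alpha_A,T)=0$ and the thermodynamic Hugoniot locus of $(T_+,\alpha_A^+)$ is unique (i.e. there is at most one such point).
   Context: Fixed constants: $R,M,\mu_A,\mu_B>0$, $0<\beta<1$, $0<T_A<T_B\le 2T_A$. The independent thermodynamic variables are $T>0$ and $\alpha_A\in(0,1)$; put $$\alpha_B=\frac{\mu_A\alpha_Ae^{-(T_B-T_A)/T}}{\mu_A\alpha_Ae^{-(T_B-T_A)/T}+\mu_B(1-\alpha_A)},\quad \alpha=\beta\alpha_A+(1-\beta)\alpha_B,$$ $$p=\frac{(1-\alpha_A)(1+\alpha)}{\mu_A\alpha_A\alpha}T^{5/2}e^{-T_A/T},\qquad v=\frac{RT}{Mp}(1+\alpha).$$ The values at the fixed state $(T_+,\alpha_A^+)$ are $\alpha_B^+,\alpha^+,p_+,v_+$; $u_A,u_+$ are given velocities. The thermodynamic Hugoniot locus of $(T_+,\alpha_A^+)$ is the set of $(T,\alpha_A)$ with $$T(1+\alpha)\left(4+\frac{p_+}{p}\right)+2\left[\beta\alpha_AT_A+(1-\beta)\alpha_BT_B\right]=T_+(1+\alpha^+)\left(4+\frac{p}{p_+}\right)+2\left[\beta\alpha_A^+T_A+(1-\beta)\alpha_B^+T_B\right].$$ The kinetic Rankine–Hugoniot condition is $G(\alpha_A,T)=0$, where $$G(\alpha_A,T)=-\frac{(u_A-u_+)^2}{p_+v_+}-\left(\frac{p}{p_+}-1\right)\left(\frac{v}{v_+}-1\right),$$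 and its compressive part is the set of its solutions with $p>p_+$ (hence $v<v_+$). *)

(* Defs.v *)
From Stdlib Require Import Reals.
Open Scope R_scope.

(* The constants of the gas mixture: [gasR] and [molM] stand for R and M.
   The sign conditions are hypotheses, collected in [admissible]. *)
Record constants : Type := Constants {
  gasR : R; molM : R; muA : R; muB : R; beta : R; TA : R; TB : R
}.

Definition admissible (c : constants) : Prop :=
  0 < gasR c /\ 0 < molM c /\ 0 < muA c /\ 0 < muB c /\
  0 < beta c < 1 /\ 0 < TA c /\ TA c < TB c /\ TB c <= 2 * TA c.

(* Thermodynamic states; the order of arguments is (alpha_A, T), as in G. *)
Definition is_state (aA T : R) : Prop := 0 < aA < 1 /\ 0 < T.

Definition alphaB (c : constants) (aA T : R) : R :=
  muA c * aA * exp (- (TB c - TA c) / T) /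
  (muA c * aA * exp (- (TB c - TA c) / T) + muB c * (1 - aA)).

Definition alpha (c : constants) (aA T : R) : R :=
  beta c * aA + (1 - beta c) * alphaB c aA T.

Definition pressure (c : constants) (aA T : R) : R :=
  (1 - aA) * (1 + alpha c aA T) / (muA c * aA * alpha c aA T)
  * Rpower T (5 / 2) * exp (- TA c / T).

Definition volume (c : constants) (aA T : R) : R :=
  gasR c * T / (molM c * pressure c aA T) * (1 + alpha c aA T).

(* Ionization energy per unit mass, divided by R / M. *)
Definition ionization_energy (c : constants) (aA T : R) : R :=
  beta c * aA * TA c + (1 - beta c) * alphaB c aA T * TB c.

(* [aAp] and [Tp] are alpha_A^+ and T_+. *)
Definition hugoniot_locus (c : constants) (aAp Tp aA T : R) : Prop :=
  is_state aA T /\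
  T * (1 + alpha c aA T) * (4 + pressure c aAp Tp / pressure c aA T)
    + 2 * ionization_energy c aA T
  = Tp * (1 + alpha c aAp Tp) * (4 + pressure c aA T / pressure c aAp Tp)
    + 2 * ionization_energy c aAp Tp.

Definition kinetic_G (c : constants) (uA up aAp Tp aA T : R) : R :=
  - ((uA - up) ^ 2 / (pressure c aAp Tp * volume c aAp Tp))
  - (pressure c aA T / pressure c aAp Tp - 1)
    * (volume c aA T / volume c aAp Tp - 1).

(* When up <> uA, kinetic_G = 0 and p > p_+ force v < v_+, so the latter is
   not a separate clause. *)
Definition compressive_kinetic_part
    (c : constants) (uA up aAp Tp aA T : R) : Prop :=
  is_state aA T /\
  kinetic_G c uA up aAp Tp aA T = 0 /\
  pressure c aAp Tp < pressure c aA T.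

(* Main.v *)
Require Import Defs.
From Stdlib Require Import Reals.
From Stdlib Require Import Lra Psatz.
Open Scope R_scope.

(* Both conditions are relations between p, v and the ionization energy E:
   with q = p - p_+ and w = v_+ - v the kinetic one reads q w = (u_A - u_+)^2,
   and on it the Hugoniot relation expresses E as a constant plus a positive
   multiple of 5 p_+ w - 3 v_+ q.  So of two intersection points the one with
   the larger p has the larger v, hence the larger T (1 + alpha), and the
   smaller E.
   If its temperature is not larger, then alpha is not smaller, so the bound on
   E forces alpha_B down and alpha_A up, all of which lower p: the points
   coincide.  If its temperature is larger, then the bound on E forces alpha_A
   and alpha down, and v ~ (alpha_A / (1 - alpha_A)) alpha T^(-3/2) e^(T_A / T)
   drops, a contradiction. *)

(** * Elementary inequalities *)

Lemma exp_neg_div_incr (k S T : R) :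
  0 < k -> 0 < S -> S < T -> exp (- k / S) < exp (- k / T).
Proof.
  intros Hk HS HST. apply exp_increasing.
  assert (/ T < / S) by (apply Rinv_lt_contravar; [nra | lra]).
  unfold Rdiv. nra.
Qed.

Lemma Rpower_exp_neg_div_incr (s k S T : R) :
  0 < s -> 0 < k -> 0 < S -> S < T ->
  Rpower S s * exp (- k / S) < Rpower T s * exp (- k / T).
Proof.
  intros Hs Hk HS HST.
  apply Rmult_gt_0_lt_compat; try apply exp_pos.
  - apply Rlt_Rpower_l; lra.
  - now apply exp_neg_div_incr.
Qed.

(** The fraction depends only on the ratio x / y and increases with it; the last hypothesis compares
    the two ratios with denominators cleared. *)
Lemma frac_add_incr (x1 y1 x2 y2 : R) :
  0 < x1 -> 0 < y1 -> 0 < x2 -> 0 < y2 -> x1 * y2 < x2 * y1 ->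
  x1 / (x1 + y1) < x2 / (x2 + y2).
Proof.
  intros. apply Rmult_lt_reg_r with ((x1 + y1) * (x2 + y2)).
  - nra.
  - replace (x1 / (x1 + y1) * ((x1 + y1) * (x2 + y2))) with (x1 * (x2 + y2))
      by (field; lra).
    replace (x2 / (x2 + y2) * ((x1 + y1) * (x2 + y2))) with (x2 * (x1 + y1))
      by (field; lra).
    nra.
Qed.

Lemma one_sub_div_decr (a b : R) : 0 < a -> a < b -> (1 - b) / b < (1 - a) / a.
Proof.
  intros Ha Hab.
  assert (/ b < / a) by (apply Rinv_lt_contravar; [nra | lra]).
  replace ((1 - b) / b) with (/ b - 1) by (field; lra).
  replace ((1 - a) / a) with (/ a - 1) by (field; lra).
  lra.
Qed.

(** In the uses below the middle factor is a function of [alpha], which is compared only weakly, so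
    strictness comes from the first or the third. *)
Lemma Rmult3_lt_compat (x1 y1 z1 x2 y2 z2 : R) :
  0 < x1 -> 0 < y1 -> 0 < z1 -> x1 <= x2 -> y1 <= y2 -> z1 <= z2 ->
  x1 < x2 \/ z1 < z2 -> x1 * y1 * z1 < x2 * y2 * z2.
Proof.
  intros Hx Hy Hz Hx12 Hy12 Hz12 H.
  assert (Hxy : x1 * y1 <= x2 * y2) by (apply Rmult_le_compat; lra).
  assert (0 < x1 * y1) by nra.
  destruct H as [H | H].
  - assert (x1 * y1 < x2 * y2) by nra. nra.
  - nra.
Qed.

(** * Positivity and monotonicity of alpha_B, p and v *)

Lemma alphaB_pos (c : constants) (a T : R) :
  admissible c -> is_state a T -> 0 < alphaB c a T.
Proof.
  intros (_ & _ & HA & HB & _) [Ha HT]. unfold alphaB.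
  pose proof (exp_pos (- (TB c - TA c) / T)) as He.
  assert (0 < muA c * a * exp (- (TB c - TA c) / T))
    by (repeat apply Rmult_lt_0_compat; lra).
  assert (0 < muB c * (1 - a)) by (apply Rmult_lt_0_compat; lra).
  apply Rdiv_lt_0_compat; lra.
Qed.

Lemma alpha_pos (c : constants) (a T : R) :
  admissible c -> is_state a T -> 0 < alpha c a T.
Proof.
  intros Hc Hs. pose proof (alphaB_pos c a T Hc Hs).
  destruct Hc as (_ & _ & _ & _ & Hb & _), Hs as [Ha _].
  unfold alpha.
  assert (0 < beta c * a) by (apply Rmult_lt_0_compat; lra).
  assert (0 < (1 - beta c) * alphaB c a T) by (apply Rmult_lt_0_compat; lra).
  lra.
Qed.

(** The odds of alpha_B are those of alpha_A times (muA / muB) e^(-(TB - TA) / T), and this factor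
    grows with T because TA < TB. *)
Lemma alphaB_incr (c : constants) (a1 T1 a2 T2 : R) :
  admissible c -> is_state a1 T1 -> is_state a2 T2 ->
  a1 <= a2 -> T1 < T2 -> alphaB c a1 T1 < alphaB c a2 T2.
Proof.
  intros (_ & _ & HA & HB & _ & HTA & HTB & _) [Ha1 HT1] [Ha2 HT2] Ha HT.
  assert (He : exp (- (TB c - TA c) / T1) < exp (- (TB c - TA c) / T2))
    by (apply exp_neg_div_incr; lra).
  pose proof (exp_pos (- (TB c - TA c) / T1)) as He1.
  unfold alphaB.
  set (e1 := exp (- (TB c - TA c) / T1)) in *.
  set (e2 := exp (- (TB c - TA c) / T2)) in *.
  apply frac_add_incr; try (repeat apply Rmult_lt_0_compat; lra).
  assert (a1 * (1 - a2) <= a2 * (1 - a1)) by lra.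
  assert (0 < a1 * (1 - a2)) by nra.
  assert (a1 * (1 - a2) * e1 < a2 * (1 - a1) * e2) by nra.
  assert (0 < muA c * muB c) by nra.
  replace (muA c * a1 * e1 * (muB c * (1 - a2)))
    with (muA c * muB c * (a1 * (1 - a2) * e1)) by ring.
  replace (muA c * a2 * e2 * (muB c * (1 - a1)))
    with (muA c * muB c * (a2 * (1 - a1) * e2)) by ring.
  now apply Rmult_lt_compat_l.
Qed.

(** Both coefficients are positive, so a bound on the energy trades a rise of [alpha] against a fall
    of [alphaB]. *)
Lemma ionization_energy_alpha (c : constants) (a T : R) :
  ionization_energy c a T
  = TA c * alpha c a T + (TB c - TA c) * ((1 - beta c) * alphaB c a T).
Proof. unfold ionization_energy, alpha. ring. Qed.

Lemma pressure_pos (c : constants) (a T : R) :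
  admissible c -> is_state a T -> 0 < pressure c a T.
Proof.
  intros Hc Hs. pose proof (alpha_pos c a T Hc Hs).
  destruct Hc as (_ & _ & HA & _), Hs as [Ha _].
  unfold pressure.
  repeat apply Rmult_lt_0_compat; try apply exp_pos; try lra.
  apply Rinv_0_lt_compat. repeat apply Rmult_lt_0_compat; lra.
Qed.

(** Up to 1 / muA, p is a product of (1 - a) / a, 1 / alpha + 1 and T^(5/2) e^(-TA / T), each
    monotone in one quantity. The order of the [alpha] values is a hypothesis, since raising a while
    lowering T does not determine it. *)
Lemma pressure_decr (c : constants) (a1 T1 a2 T2 : R) :
  admissible c -> is_state a1 T1 -> is_state a2 T2 ->
  a1 <= a2 -> alpha c a1 T1 <= alpha c a2 T2 -> T2 <= T1 ->
  a1 < a2 \/ T2 < T1 -> pressure c a2 T2 < pressure c a1 T1.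
Proof.
  intros Hc Hs1 Hs2 Ha Hal HT Hlt.
  pose proof (alpha_pos c a1 T1 Hc Hs1) as Hp1.
  pose proof (alpha_pos c a2 T2 Hc Hs2) as Hp2.
  destruct Hc as (_ & _ & HA & _ & _ & HTA & _), Hs1 as [Ha1 HT1], Hs2 as [Ha2 HT2].
  assert (E : forall a T, 0 < a -> 0 < alpha c a T ->
    pressure c a T = / muA c *
      ((1 - a) / a * (/ alpha c a T + 1) * (Rpower T (5 / 2) * exp (- TA c / T)))).
  { intros a T H1 H2. unfold pressure. field. lra. }
  rewrite !E by lra.
  apply Rmult_lt_compat_l; [now apply Rinv_0_lt_compat |].
  assert (/ alpha c a2 T2 <= / alpha c a1 T1) by (apply Rinv_le_contravar; lra).
  assert (0 < / alpha c a2 T2) by (now apply Rinv_0_lt_compat).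
  assert (Hodds : a1 < a2 -> (1 - a2) / a2 < (1 - a1) / a1)
    by (intros; apply one_sub_div_decr; lra).
  assert (Hg : T2 < T1 -> Rpower T2 (5 / 2) * exp (- TA c / T2)
                        < Rpower T1 (5 / 2) * exp (- TA c / T1))
    by (intros; apply Rpower_exp_neg_div_incr; lra).
  apply Rmult3_lt_compat.
  - apply Rdiv_lt_0_compat; lra.
  - lra.
  - apply Rmult_lt_0_compat; apply exp_pos.
  - destruct (Rle_lt_or_eq_dec _ _ Ha) as [H' | ->]; [apply Hodds in H'; lra | lra].
  - lra.
  - destruct (Rle_lt_or_eq_dec _ _ HT) as [H' | ->]; [apply Hg in H'; lra | lra].
  - destruct Hlt; [left | right]; auto.
Qed.

(** The equation of state, used to trade T (1 + alpha) for p v. *)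
Lemma pressure_volume (c : constants) (a T : R) :
  admissible c -> is_state a T ->
  gasR c * (T * (1 + alpha c a T)) = molM c * (pressure c a T * volume c a T).
Proof.
  intros Hc Hs. pose proof (pressure_pos c a T Hc Hs).
  destruct Hc as (_ & HM & _). unfold volume. field. lra.
Qed.

Lemma volume_pos (c : constants) (a T : R) :
  admissible c -> is_state a T -> 0 < volume c a T.
Proof.
  intros Hc Hs. pose proof (pressure_pos c a T Hc Hs).
  pose proof (alpha_pos c a T Hc Hs).
  destruct Hc as (HR & HM & _), Hs as [_ HT]. unfold volume.
  repeat apply Rmult_lt_0_compat; try lra.
  apply Rinv_0_lt_compat. apply Rmult_lt_0_compat; lra.
Qed.

(** Inserting p into v cancels 1 + alpha and one power of T; 1 / v is then a constant times three
    positive factors, each monotone in one of a, [alpha] and T. *)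
Lemma volume_decr (c : constants) (a1 T1 a2 T2 : R) :
  admissible c -> is_state a1 T1 -> is_state a2 T2 ->
  a2 <= a1 -> alpha c a2 T2 <= alpha c a1 T1 -> T1 < T2 ->
  volume c a2 T2 < volume c a1 T1.
Proof.
  intros Hc Hs1 Hs2 Ha Hal HT.
  pose proof (alpha_pos c a1 T1 Hc Hs1) as Hp1.
  pose proof (alpha_pos c a2 T2 Hc Hs2) as Hp2.
  destruct Hc as (HR & HM & HA & _ & _ & HTA & _), Hs1 as [Ha1 HT1], Hs2 as [Ha2 HT2].
  assert (E : forall a T, 0 < a < 1 -> 0 < T -> 0 < alpha c a T ->
    volume c a T = gasR c * muA c / molM c *
      / ((1 - a) / a * / alpha c a T * (Rpower T (3 / 2) * exp (- TA c / T)))).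
  { intros a T H1 H2 H3. unfold volume, pressure.
    replace (Rpower T (5 / 2)) with (T * Rpower T (3 / 2)).
    - pose proof (exp_pos (- TA c / T)).
      assert (0 < Rpower T (3 / 2)) by apply exp_pos.
      field. repeat split; lra.
    - rewrite <- (Rpower_1 T) at 1 by assumption.
      rewrite <- Rpower_plus. f_equal. lra. }
  rewrite !E by lra.
  apply Rmult_lt_compat_l.
  { apply Rdiv_lt_0_compat; [apply Rmult_lt_0_compat |]; lra. }
  assert (/ alpha c a1 T1 <= / alpha c a2 T2) by (apply Rinv_le_contravar; lra).
  assert (0 < / alpha c a1 T1) by (now apply Rinv_0_lt_compat).
  assert (0 < / alpha c a2 T2) by (now apply Rinv_0_lt_compat).
  assert (Hodds : forall a, 0 < a < 1 -> 0 < (1 - a) / a)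
    by (intros; apply Rdiv_lt_0_compat; lra).
  assert (Hg : forall T, 0 < Rpower T (3 / 2) * exp (- TA c / T))
    by (intros; apply Rmult_lt_0_compat; apply exp_pos).
  assert (HgT : Rpower T1 (3 / 2) * exp (- TA c / T1)
              < Rpower T2 (3 / 2) * exp (- TA c / T2))
    by (apply Rpower_exp_neg_div_incr; lra).
  apply Rinv_lt_contravar.
  - repeat apply Rmult_lt_0_compat; auto; try apply exp_pos;
      try lra; apply Rinv_0_lt_compat; lra.
  - apply Rmult3_lt_compat; auto; try lra.
    destruct (Rle_lt_or_eq_dec _ _ Ha) as [H' | ->]; [| lra].
    left. apply one_sub_div_decr; lra.
Qed.

(** * The two conditions in terms of p, v and the ionization energy *)

Lemma kinetic_G_eq0 (c : constants) (uA up a0 T0 a T : R) :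
  admissible c -> is_state a0 T0 -> kinetic_G c uA up a0 T0 a T = 0 ->
  (pressure c a T - pressure c a0 T0) * (volume c a0 T0 - volume c a T)
  = (uA - up) ^ 2.
Proof.
  intros Hc Hs HG.
  pose proof (pressure_pos c a0 T0 Hc Hs). pose proof (volume_pos c a0 T0 Hc Hs).
  unfold kinetic_G in HG.
  set (p0 := pressure c a0 T0) in *. set (v0 := volume c a0 T0) in *.
  set (p := pressure c a T) in *. set (v := volume c a T) in *.
  assert (E : - ((uA - up) ^ 2 / (p0 * v0)) - (p / p0 - 1) * (v / v0 - 1)
            = ((p - p0) * (v0 - v) - (uA - up) ^ 2) / (p0 * v0))
    by (field; lra).
  rewrite E in HG.
  apply (Rmult_eq_compat_r (p0 * v0)) in HG.
  unfold Rdiv in HG.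
  rewrite Rmult_assoc, Rinv_l in HG by nra. lra.
Qed.

Lemma hugoniot_pv (c : constants) (a0 T0 a T : R) :
  admissible c -> is_state a0 T0 -> hugoniot_locus c a0 T0 a T ->
  let p := pressure c a T in let p0 := pressure c a0 T0 in
  let v := volume c a T in let v0 := volume c a0 T0 in
  2 * gasR c * (ionization_energy c a T - ionization_energy c a0 T0)
  = molM c * (v0 * (4 * p0 + p) - v * (4 * p + p0)).
Proof.
  intros Hc Hs0 [Hs HH] p p0 v v0.
  pose proof (pressure_pos c a0 T0 Hc Hs0).
  pose proof (pressure_pos c a T Hc Hs).
  pose proof (pressure_volume c a0 T0 Hc Hs0) as E0.
  pose proof (pressure_volume c a T Hc Hs) as E.
  fold p p0 in HH, E0, E. fold v in E. fold v0 in E0.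
  set (X := T * (1 + alpha c a T)) in *.
  set (X0 := T0 * (1 + alpha c a0 T0)) in *.
  assert (EX : gasR c * (X * (4 + p0 / p)) = molM c * (v * (4 * p + p0))).
  { rewrite <- Rmult_assoc, E. field. subst p. lra. }
  assert (EX0 : gasR c * (X0 * (4 + p / p0)) = molM c * (v0 * (4 * p0 + p))).
  { rewrite <- Rmult_assoc, E0. field. subst p0. lra. }
  apply (Rmult_eq_compat_l (gasR c)) in HH.
  rewrite !Rmult_plus_distr_l in HH, EX, EX0.
  lra.
Qed.

Lemma intersection_comparison
    (c : constants) (uA up a0 T0 a1 T1 a2 T2 : R) :
  admissible c -> is_state a0 T0 -> up <> uA ->
  compressive_kinetic_part c uA up a0 T0 a1 T1 ->
  hugoniot_locus c a0 T0 a1 T1 ->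
  compressive_kinetic_part c uA up a0 T0 a2 T2 ->
  hugoniot_locus c a0 T0 a2 T2 ->
  pressure c a1 T1 <= pressure c a2 T2 ->
  volume c a1 T1 <= volume c a2 T2 /\
  ionization_energy c a2 T2 <= ionization_energy c a1 T1.
Proof.
  intros Hc Hs0 Hu (_ & HG1 & Hlt1) HH1 (_ & HG2 & Hlt2) HH2 Hp.
  pose proof (volume_pos c a0 T0 Hc Hs0) as Hv0.
  pose proof (pressure_pos c a0 T0 Hc Hs0) as Hp0.
  apply kinetic_G_eq0 in HG1, HG2; auto.
  apply hugoniot_pv in HH1, HH2; auto.
  cbv zeta in HH1, HH2.
  destruct Hc as (HR & HM & _).
  assert (HJ : 0 < (uA - up) ^ 2) by (rewrite <- Rsqr_pow2; apply Rsqr_pos_lt; lra).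
  set (J := (uA - up) ^ 2) in *. clearbody J.
  set (p0 := pressure c a0 T0) in *. set (v0 := volume c a0 T0) in *.
  set (p1 := pressure c a1 T1) in *. set (v1 := volume c a1 T1) in *.
  set (p2 := pressure c a2 T2) in *. set (v2 := volume c a2 T2) in *.
  assert (Hv : v1 <= v2).
  (* Here v0 - v1 > 0 because J > 0 and p1 > p0. If v2 < v1, then v0 - v2 exceeds v0 - v1 while p2 -
     p0 is at least p1 - p0, so the second product would exceed J. *)
  { destruct (Rle_or_lt v1 v2) as [| Hlt]; [assumption | exfalso].
    assert (0 < v0 - v1) by nra.
    nra. }
  split; [assumption |].
  (* The kinetic relation eliminates the product p v, leaving an expression affine and decreasing in
     p and in v. *)
  assert (E : forall p v, (p - p0) * (v0 - v) = J ->
    v0 * (4 * p0 + p) - v * (4 * p + p0)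
    = 4 * J + 5 * p0 * (v0 - v) - 3 * v0 * (p - p0))
    by (intros p v <-; ring).
  rewrite (E p1 v1 HG1) in HH1. rewrite (E p2 v2 HG2) in HH2.
  assert (p0 * v1 <= p0 * v2) by nra.
  assert (v0 * p1 <= v0 * p2) by nra.
  assert (molM c * (4 * J + 5 * p0 * (v0 - v2) - 3 * v0 * (p2 - p0))
       <= molM c * (4 * J + 5 * p0 * (v0 - v1) - 3 * v0 * (p1 - p0)))
    by (apply Rmult_le_compat_l; lra).
  nra.
Qed.

(** * Comparison of two states and uniqueness *)

Lemma states_eq (c : constants) (a1 T1 a2 T2 : R) :
  admissible c -> is_state a1 T1 -> is_state a2 T2 ->
  pressure c a1 T1 <= pressure c a2 T2 ->
  volume c a1 T1 <= volume c a2 T2 ->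
  ionization_energy c a2 T2 <= ionization_energy c a1 T1 ->
  a1 = a2 /\ T1 = T2.
Proof.
  intros Hc Hs1 Hs2 Hp Hv HE.
  pose proof (pressure_pos c a1 T1 Hc Hs1).
  pose proof (volume_pos c a1 T1 Hc Hs1).
  pose proof (pressure_volume c a1 T1 Hc Hs1) as E1.
  pose proof (pressure_volume c a2 T2 Hc Hs2) as E2.
  pose proof (alpha_pos c a2 T2 Hc Hs2).
  rewrite !ionization_energy_alpha in HE.
  pose proof Hc as (HR & HM & _ & _ & Hb & HTA & HTB & _).
  assert (HX : T1 * (1 + alpha c a1 T1) <= T2 * (1 + alpha c a2 T2)).
  { apply Rmult_le_reg_l with (gasR c); [assumption |].
    rewrite E1, E2. apply Rmult_le_compat_l; [lra |].
    apply Rmult_le_compat; lra. }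
  pose proof Hs1 as [_ HT1]. pose proof Hs2 as [_ HT2].
  destruct (Rle_or_lt T2 T1) as [HT | HT].
  - assert (Hal : alpha c a1 T1 <= alpha c a2 T2) by nra.
    (* The [alpha] term of the energy has not dropped, so the [alphaB] term must not rise; then beta
       a = alpha - (1 - beta) alpha_B cannot drop. *)
    assert (HB : (1 - beta c) * alphaB c a2 T2 <= (1 - beta c) * alphaB c a1 T1)
      by nra.
    assert (Ha : a1 <= a2) by (unfold alpha in Hal; nra).
    destruct (Rle_lt_or_eq_dec _ _ Ha) as [Hlt | Heq];
      [| destruct (Rle_lt_or_eq_dec _ _ HT) as [Hlt | Heq']].
    + pose proof (pressure_decr c a1 T1 a2 T2 Hc Hs1 Hs2 Ha Hal HT (or_introl Hlt)).
      lra.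
    + pose proof (pressure_decr c a1 T1 a2 T2 Hc Hs1 Hs2 Ha Hal HT (or_intror Hlt)).
      lra.
    + split; lra.
  - exfalso.
    assert (Ha : a2 <= a1).
    { destruct (Rle_or_lt a2 a1) as [| Ha]; [assumption | exfalso].
      (* With a and T both larger, [alphaB] and [alpha] rise, and so does the energy, against
         [HE]. *)
      pose proof (alphaB_incr c a1 T1 a2 T2 Hc Hs1 Hs2 (Rlt_le _ _ Ha) HT).
      assert ((1 - beta c) * alphaB c a1 T1 < (1 - beta c) * alphaB c a2 T2) by nra.
      assert (alpha c a1 T1 < alpha c a2 T2) by (unfold alpha; nra).
      nra. }
    assert (Hal : alpha c a2 T2 <= alpha c a1 T1).
    { destruct (Rle_or_lt (alpha c a2 T2) (alpha c a1 T1)) as [| Hal];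
        [assumption | exfalso].
      (* As a2 <= a1, [alpha] could rise only through [alphaB], which would again raise the
         energy. *)
      assert ((1 - beta c) * alphaB c a1 T1 < (1 - beta c) * alphaB c a2 T2)
        by (unfold alpha in Hal; nra).
      nra. }
    pose proof (volume_decr c a1 T1 a2 T2 Hc Hs1 Hs2 Ha Hal HT). lra.
Qed.

Theorem theorem13 :
  forall (c : constants), admissible c ->
  forall (aAp Tp uA up : R),
    0 < Tp -> 0 < aAp < 1 -> up <> uA ->
  forall (aA1 T1 aA2 T2 : R),
    aAp < aA1 < 1 ->
    compressive_kinetic_part c uA up aAp Tp aA1 T1 ->
    hugoniot_locus c aAp Tp aA1 T1 ->
    aAp < aA2 < 1 ->
    compressive_kinetic_part c uA up aAp Tp aA2 T2 ->
    hugoniot_locus c aAp Tp aA2 T2 ->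
    aA1 = aA2 /\ T1 = T2.
Proof.
  intros c Hc aAp Tp uA up HTp Hap Hu aA1 T1 aA2 T2 _ HK1 HH1 _ HK2 HH2.
  assert (Hs0 : is_state aAp Tp) by (split; assumption).
  pose proof HK1 as [Hs1 _]. pose proof HK2 as [Hs2 _].
  (* The two points play symmetric roles, so they may be ordered by pressure. *)
  destruct (Rle_or_lt (pressure c aA1 T1) (pressure c aA2 T2)) as [Hp | Hp].
  - destruct (intersection_comparison c uA up aAp Tp aA1 T1 aA2 T2) as [Hv HE]; auto.
    now apply (states_eq c).
  - apply Rlt_le in Hp.
    destruct (intersection_comparison c uA up aAp Tp aA2 T2 aA1 T1) as [Hv HE]; auto.
    destruct (states_eq c aA2 T2 aA1 T1); auto.
Qed.
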